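(* Let $(S,\diamond)$ be a finite nonassociative RA-loop and for $s\in S$ let $\hat s=\{(x,s\diamond x):x\in S\}$. Then $(S,\{\hat s\}_{s\in S})$ is an autonomous Jordan scheme, i.e. it is a Jordan scheme which is not an algebraic fusion of any coherent configuration on $S$.
   Context: A Jordan scheme on a finite set $\Omega$ is a partition $S$ of $\Omega\times\Omega$ into nonempty relations with $1_\Omega=\{(\omega,\omega)\}\in S$, $s^t=\{(\beta,\alpha):(\alpha,\beta)\in s\}\in S$ for all $s\in S$, and such that the complex span of the $0/1$ adjacency matrices $\underline{s}$ is closed under $X\star Y=\tfrac12(XY+YX)$. A coherent configuration $(\Omega,C)$ is a partition of $\Omega^2$ into nonempty relations whose diagonal is a union of members, closed under transposition, with $\mathbb{C}[C]=\mathrm{span}\{\underline{c}\}$ closed under matrix multiplication. $\mathsf{JAut}(\Omega,C)$ is the group of permutations $\phi$ of $C$ whose linear extension $\underline{c}\mapsto\underline{\phi(c)}$ is an automorphism of $(\mathbb{C}[C],\star)$. For $\Phi\leq\mathsf{JAut}(\Omega,C)$, the algebraic fusion of $(\Omega,C)$ by $\Phi$ is the partition $\{\Phi(c):c\in C\}$ with $\Phi(c)=\bigcup_{\phi\in\Phi}\phi(c)$. A loop $(S,\diamond)$ is an RA-loop if for every commutative associative ring $R$ the loop ring $RS$ is alternative ($(xx)y=x(xy)$, $(yx)x=y(xx)$). *)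

(* Defs.v *)
From HB Require Import structures.
From mathcomp Require Import all_boot all_order all_algebra all_fingroup.
From mathcomp Require Import reals complex.

Set Implicit Arguments.
Unset Strict Implicit.
Unset Printing Implicit Defensive.

Import GRing.Theory.
Local Open Scope ring_scope.

Definition diag_rel (T : finType) : {set T * T} := [set p | p.1 == p.2].

Definition transp_rel (T : finType) (s : {set T * T}) : {set T * T} :=
  [set p | (p.2, p.1) \in s].

(* Matrices over the index set T are encoded as matrices of order #|T| through
   the canonical enumeration [enum_val : 'I_#|T| -> T]. *)
Definition adj_mx (R : realType) (T : finType) (s : {set T * T}) :
    'M[R[i]]_#|T| :=
  \matrix_(i, j) ((enum_val i, enum_val j) \in s)%:R.

Definition adj_span (R : realType) (T : finType) (C : {set {set T * T}}) :
    {vspace 'M[R[i]]_#|T|} :=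
  <<[seq adj_mx R c | c <- enum C]>>%VS.

Definition jordan_mul (R : realType) (n : nat) (X Y : 'M[R[i]]_n) :
    'M[R[i]]_n :=
  2%:R^-1 *: (X *m Y + Y *m X).

Definition jordan_scheme (R : realType) (T : finType)
    (S : {set {set T * T}}) : Prop :=
  [/\ partition S [set: T * T],
      diag_rel T \in S,
      {in S, forall s, transp_rel s \in S} &
      {in adj_span R S &, forall X Y, jordan_mul X Y \in adj_span R S}].

Definition coherent_configuration (R : realType) (T : finType)
    (C : {set {set T * T}}) : Prop :=
  [/\ partition C [set: T * T],
      exists2 D : {set {set T * T}}, D \subset C & cover D = diag_rel T,
      {in C, forall c, transp_rel c \in C} &
      {in adj_span R C &, forall X Y, X *m Y \in adj_span R C}].

Definition jordan_automorphism (R : realType) (n : nat)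
    (A : {vspace 'M[R[i]]_n}) (f : 'End('M[R[i]]_n)) : Prop :=
  [/\ (f @: A)%VS = A,
      {in A &, injective f} &
      {in A &, forall X Y, f (jordan_mul X Y) = jordan_mul (f X) (f Y)}].

(* A permutation of C is encoded as a permutation of all relations that is
   supported on C.  The linear extension of phi is represented by any
   endomorphism f of the full matrix space sending the matrix of c to that of
   phi c; only its restriction to [adj_span R C] matters, and this restriction
   is determined by phi. *)
Definition JAut (R : realType) (T : finType) (C : {set {set T * T}})
    (phi : {perm {set T * T}}) : Prop :=
  perm_on C phi /\
  exists2 f : 'End('M[R[i]]_#|T|),
    {in C, forall c, f (adj_mx R c) = adj_mx R (phi c)} &
    jordan_automorphism (adj_span R C) f.

Definition fusion (T : finType) (Phi : {set {perm {set T * T}}})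
    (C : {set {set T * T}}) : {set {set T * T}} :=
  [set \bigcup_(phi in Phi) (phi : {perm _}) c | c in C].

Definition is_algebraic_fusion (R : realType) (T : finType)
    (C S : {set {set T * T}}) : Prop :=
  exists2 Phi : {group {perm {set T * T}}},
    {in Phi, forall phi, JAut R C phi} & S = fusion Phi C.

Definition autonomous_jordan_scheme (R : realType) (T : finType)
    (S : {set {set T * T}}) : Prop :=
  jordan_scheme R S /\
  forall C : {set {set T * T}},
    coherent_configuration R C -> ~ is_algebraic_fusion R C S.

Definition is_loop (S : Type) (op : S -> S -> S) : Prop :=
  [/\ exists e : S, left_id e op /\ right_id e op,
      forall a : S, bijective (op a) &
      forall a : S, bijective (op^~ a)].

(* The loop ring KS: elements are functions S -> K (formal K-linear
   combinations of S), multiplied by convolution along op. *)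
Definition loop_ring_mul (K : comPzRingType) (S : finType) (op : S -> S -> S)
    (f g : {ffun S -> K}) : {ffun S -> K} :=
  [ffun z => \sum_(p : S * S | op p.1 p.2 == z) f p.1 * g p.2].

Definition alternative (A : Type) (mul : A -> A -> A) : Prop :=
  forall x y : A,
    mul (mul x x) y = mul x (mul x y) /\ mul (mul y x) x = mul y (mul x x).

Definition RA_loop (S : finType) (op : S -> S -> S) : Prop :=
  is_loop op /\
  forall K : comPzRingType, alternative (@loop_ring_mul K S op).

Definition hat (S : finType) (op : S -> S -> S) (s : S) : {set S * S} :=
  [set p | p.2 == op s p.1].

(* Main.v *)
(** If [S] is the fusion of a coherent configuration by a group [Phi] of Jordan
    automorphisms, its span consists of the [Phi]-fixed elements of a semiprime
    matrix algebra.  By an argument going back to Jacobson, Rickart and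
    Herstein, a Jordan automorphism of such an algebra preserves the tetrads
    [abcd + dcba], although these are not Jordan polynomials.  So the span of
    the left translations of the loop would be closed under tetrads, and
    counting on the tetrads of [c], [(ab)^-1], [b], [a] yields associativity. *)
Require Import Defs.
From mathcomp Require Import all_boot all_order all_algebra all_fingroup.
From mathcomp Require Import reals complex.
From Stdlib Require Ncring Ncring_tac.

Set Implicit Arguments.
Unset Strict Implicit.
Unset Printing Implicit Defensive.

Import GRing.Theory Num.Theory.
Local Open Scope ring_scope.

(** * Noncommutative ring identities for triple products *)

Section NoncommutativeIdentities.

Import Ncring Ncring_tac.
Local Open Scope ring_scope.

Variable R : pzRingType.

#[local] Instance pzRing_ops :
  @Ring_ops R 0 1 +%R *%R (fun x y => x - y) -%R eq := {}.

#[local] Instance pzRing_Ring : Ring (Ro := pzRing_ops).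
Proof.
split.
- exact: eq_equivalence.
- by move=> ?? -> ?? ->.
- by move=> ?? -> ?? ->.
- by move=> ?? -> ?? ->.
- by move=> ?? ->.
- exact: add0r.
- exact: addrC.
- exact: addrA.
- exact: mul1r.
- exact: mulr1.
- exact: mulrA.
- exact: mulrDl.
- by move=> x y z; exact: mulrDr.
- by [].
- exact: subrr.
Qed.

Lemma double_triple_product (x y : R) :
  x * y * x + x * y * x =
  x * (x * y + y * x) + (x * y + y * x) * x - (x * x * y + y * (x * x)).
Proof. non_commutative_ring. Qed.

Lemma linearized_triple_product (x y z : R) :
  x * y * z + z * y * x = (x + z) * y * (x + z) - x * y * x - z * y * z.
Proof. non_commutative_ring. Qed.

(** Meant for [w = f (x * y)], [p = f x * f y], [q = f y * f x]: then [p + q - w] is [f (y * x)] for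
    a Jordan homomorphism [f]. *)
Lemma defect_expansion (p q r w : R) :
  (w - p) * r * (w - q) + (w - q) * r * (w - p) =
  p * r * q + q * r * p - (w * r * (p + q - w) + (p + q - w) * r * w).
Proof. non_commutative_ring. Qed.

End NoncommutativeIdentities.

(** * Jordan epimorphisms of semiprime rings without 2-torsion *)

Section JordanEpimorphism.

Variables (R : pzRingType) (A : {pred R}) (f : {additive R -> R}).
Hypothesis R_tf : forall x : R, x + x = 0 -> x = 0.
Hypothesis AD : {in A &, forall x y, x + y \in A}.
Hypothesis AN : {in A, forall x, - x \in A}.
Hypothesis AM : {in A &, forall x y, x * y \in A}.
Hypothesis A_semiprime :
  {in A, forall x, {in A, forall r, x * r * x = 0} -> x = 0}.
Hypothesis fA : {in A, forall x, f x \in A}.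
Hypothesis f_onto : {in A, forall y, exists2 x, x \in A & f x = y}.
Hypothesis fJ : {in A &, forall x y, f (x * y + y * x) = f x * f y + f y * f x}.

Let AB : {in A &, forall x y, x - y \in A}.
Proof. by move=> x y xA yA; rewrite AD ?AN. Qed.

(** The defects of [f] from being multiplicative ([u]) and antimultiplicative ([v]). *)
Let u x y := f (x * y) - f x * f y.
Let v x y := f (x * y) - f y * f x.

Let uA x y : x \in A -> y \in A -> u x y \in A.
Proof. by move=> xA yA; rewrite AB ?AM ?fA ?AM. Qed.

Let vA x y : x \in A -> y \in A -> v x y \in A.
Proof. by move=> xA yA; rewrite AB ?AM ?fA ?AM. Qed.

Let uDl x y z : u (x + y) z = u x z + u y z.
Proof. by rewrite /u raddfD !mulrDl raddfD /= opprD addrACA. Qed.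

Let vDl x y z : v (x + y) z = v x z + v y z.
Proof. by rewrite /v raddfD mulrDl mulrDr raddfD /= opprD addrACA. Qed.

Let vDr x y z : v x (y + z) = v x y + v x z.
Proof. by rewrite /v raddfD mulrDl mulrDr raddfD /= opprD addrACA. Qed.

Let uDr x y z : u x (y + z) = u x y + u x z.
Proof. by rewrite /u raddfD !mulrDr raddfD /= opprD addrACA. Qed.

Lemma double_inj (x y : R) : x + x = y + y -> x = y.
Proof.
move=> e; apply/eqP; rewrite -subr_eq0; apply/eqP/R_tf.
by rewrite addrACA e -opprD subrr.
Qed.

Lemma jordan_square x : x \in A -> f (x * x) = f x * f x.
Proof. by move=> xA; apply: double_inj; rewrite -raddfD fJ. Qed.

Lemma jordan_triple x y :
  x \in A -> y \in A -> f (x * y * x) = f x * f y * f x.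
Proof.
move=> xA yA; apply: double_inj; rewrite -raddfD !double_triple_product.
by rewrite raddfB !fJ ?AD ?AM // jordan_square.
Qed.

Lemma jordan_triad x y z : x \in A -> y \in A -> z \in A ->
  f (x * y * z + z * y * x) = f x * f y * f z + f z * f y * f x.
Proof.
move=> xA yA zA; rewrite !linearized_triple_product !raddfB.
by rewrite !jordan_triple ?AD // raddfD.
Qed.

(** Write [r = f s]. The image of [(xy)s(yx) + (yx)s(xy) = x(ysy)x + y(xsx)y] can be computed by the
    triad rule or by nested triple products; the difference of the two results is the sum of the
    defect products. *)
Lemma defect_anticommute x y r : x \in A -> y \in A -> r \in A ->
  u x y * r * v x y = - (v x y * r * u x y).
Proof.
move=> xA yA /f_onto[s sA <-]; apply/eqP; rewrite -addr_eq0; apply/eqP.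
rewrite defect_expansion.
have -> : f x * f y + f y * f x - f (x * y) = f (y * x).
  by rewrite -fJ // raddfD addrC addKr.
rewrite -jordan_triad ?AM //.
have -> : x * y * s * (y * x) + y * x * s * (x * y) =
    x * (y * s * y) * x + y * (x * s * x) * y by rewrite !mulrA.
by rewrite raddfD !jordan_triple ?AM // !mulrA subrr.
Qed.

(* With X = u x y, Y = v x y and XrY = - YrX for every r, moving the letters
   of XrYsXrY around in two ways changes its sign an odd number of times. *)
Lemma defect_orthogonal_diag x y r : x \in A -> y \in A -> r \in A ->
  u x y * r * v x y = 0.
Proof.
move=> xA yA rA; have XA := uA xA yA; have YA := vA xA yA.
have E t (tA : t \in A) := defect_anticommute xA yA tA.
set X := u x y in XA E *; set Y := v x y in YA E *.
apply: A_semiprime => [|s sA]; first by rewrite !AM.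
have YsX : Y * s * X = - (X * s * Y) by rewrite E // opprK.
apply: R_tf; apply/eqP; rewrite addr_eq0; apply/eqP.
transitivity (X * r * (Y * s * X) * (r * Y)); first by rewrite !mulrA.
rewrite YsX mulrN mulNr.
transitivity (- (X * (r * X * s) * Y * (r * Y))); first by rewrite !mulrA.
rewrite E ?AM // mulNr opprK.
transitivity (Y * r * X * s * (X * r * Y)); first by rewrite !mulrA.
by rewrite -[Y * r * X]opprK -E // !mulNr.
Qed.

(** Linearizing the diagonal case in the first argument allows [x] and [z] to be swapped up to sign.
    After one swap in [PsP], with [P] the product in question, the outer factors are [u x y] and
    [v x y], so semiprimeness applies. *)
Lemma defect_orthogonal_left x y z r :
  x \in A -> y \in A -> z \in A -> r \in A -> u x y * r * v z y = 0.
Proof.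
move=> xA yA zA rA.
have E t (tA : t \in A) : u x y * t * v z y = - (u z y * t * v x y).
  have := defect_orthogonal_diag (AD xA zA) yA tA.
  rewrite uDl vDl 2!mulrDl !(mulrDr _ (v x y)).
  rewrite !defect_orthogonal_diag // addr0 add0r.
  by move/eqP; rewrite addr_eq0 => /eqP.
apply: A_semiprime => [|s sA]; first by rewrite !AM ?uA ?vA.
rewrite [X in _ * X]E // mulrN.
transitivity (- (u x y * (r * v z y * s * u z y * r) * v x y)).
  by rewrite !mulrA.
by rewrite defect_orthogonal_diag ?oppr0 // !AM ?uA ?vA.
Qed.

Lemma defect_orthogonal x y z t r :
  x \in A -> y \in A -> z \in A -> t \in A -> r \in A ->
  u x y * r * v z t = 0.
Proof.
move=> xA yA zA tA rA.
(* The same linearize-and-sandwich argument, now in the second argument. *)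
have E q (qA : q \in A) : u x y * q * v z t = - (u x t * q * v z y).
  have := defect_orthogonal_left xA (AD yA tA) zA qA.
  rewrite uDr vDr 2!mulrDl !(mulrDr _ (v z y)).
  rewrite !defect_orthogonal_left // addr0 add0r.
  by move/eqP; rewrite addrC addr_eq0 => /eqP ->; rewrite opprK.
apply: A_semiprime => [|s sA]; first by rewrite !AM ?uA ?vA.
rewrite [X in _ * X]E // mulrN.
transitivity (- (u x y * (r * v z t * s * u x t * r) * v z y)).
  by rewrite !mulrA.
by rewrite defect_orthogonal_left ?oppr0 // !AM ?uA ?vA.
Qed.

(* If [u] vanished, [f] would be multiplicative, and if [v] vanished it would
   be antimultiplicative; either way tetrads are preserved.  Hence the error
   [T] is annihilated by all [v]'s, and then by itself. *)
Lemma jordan_tetrad a b c d : a \in A -> b \in A -> c \in A -> d \in A ->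
  f (a * b * c * d + d * c * b * a) =
  f a * f b * f c * f d + f d * f c * f b * f a.
Proof.
move=> aA bA cA dA; apply/eqP; rewrite -subr_eq0; apply/eqP.
set T := _ - _.
have TA : T \in A by rewrite AB ?AD ?fA ?AD ?AM ?fA.
have TY x y r : x \in A -> y \in A -> r \in A -> T * r * v x y = 0.
  move=> xA yA rA.
  have E s t q : s \in A -> t \in A -> q \in A ->
      f (s * t) * q * v x y = f s * f t * q * v x y.
    by move=> sA tA qA; apply/eqP; rewrite -subr_eq0 -!mulrBl defect_orthogonal.
  rewrite /T raddfD !mulrBl !mulrDl.
  apply/eqP; rewrite subr_eq0; apply/eqP; congr (_ + _).
    rewrite E ?AM // -(mulrA _ _ r) E ?AM ?fA //.
    by rewrite -(mulrA _ _ (_ * r)) E ?AM ?fA // !mulrA.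
  rewrite E ?AM // -(mulrA _ _ r) E ?AM ?fA //.
  by rewrite -(mulrA _ _ (_ * r)) E ?AM ?fA // !mulrA.
apply: A_semiprime => // r rA.
have E s t q : s \in A -> t \in A -> q \in A ->
    T * q * f (s * t) = T * (q * f t) * f s.
  move=> sA tA qA; apply/eqP; rewrite -subr_eq0 mulrA -[X in _ - X]mulrA.
  by rewrite -mulrBr TY.
have Tw w x y z : w \in A -> x \in A -> y \in A -> z \in A ->
    T * r * f (w * x * y * z) = T * r * (f z * f y * f x * f w).
  by move=> wA xA yA zA; rewrite !E ?AM ?fA // !mulrA.
rewrite {2}/T raddfD mulrBr !mulrDr [X in _ - X]addrC !Tw //.
by rewrite subrr.
Qed.

End JordanEpimorphism.

(** * Positivity of the conjugate transpose *)

Section Adjoint.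

Variable K : numClosedFieldType.

Definition adjmx m n (X : 'M[K]_(m, n)) : 'M[K]_(n, m) := (map_mx Num.conj X)^T.

Lemma mulmx_adj_eq0 m n (X : 'M[K]_(m, n)) : X *m adjmx X = 0 -> X = 0.
Proof.
move=> XX0; apply/matrixP => i j; rewrite mxE.
have /psumr_eq0P : \sum_k `|X i k| ^+ 2 = 0.
  transitivity ((X *m adjmx X) i i); last by rewrite XX0 mxE.
  by rewrite mxE; apply: eq_bigr => k _; rewrite !mxE normCK.
move=> /(_ (fun k _ => exprn_ge0 2 (normr_ge0 (X i k))) j isT)/eqP.
by rewrite expf_eq0 /= normr_eq0 => /eqP.
Qed.

Lemma adjmxM m n p (X : 'M[K]_(m, n)) (Y : 'M[K]_(n, p)) :
  adjmx (X *m Y) = adjmx Y *m adjmx X.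
Proof. by rewrite /adjmx map_mxM trmx_mul. Qed.

Lemma adjmxK m n : cancel (@adjmx m n) (@adjmx n m).
Proof. by move=> X; apply/matrixP => i j; rewrite !mxE conjCK. Qed.

(** Positivity is used twice, for the self-adjoint matrix [X *m adjmx X] and then for [X]. *)
Lemma mulmx_adj_mul_eq0 m n (X : 'M[K]_(m, n)) : X *m adjmx X *m X = 0 -> X = 0.
Proof.
move=> e; apply: mulmx_adj_eq0; apply: mulmx_adj_eq0.
by rewrite adjmxM adjmxK mulmxA e mul0mx.
Qed.

End Adjoint.

(** * Spans of adjacency matrices and their Jordan automorphisms *)

Section RelationSpan.

Variables (R : realType) (T : finType) (C : {set {set T * T}}).

Definition entry (X : 'M[R[i]]_#|T|) (p : T * T) : R[i] :=
  X (enum_rank p.1) (enum_rank p.2).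

Lemma entry_adj (s : {set T * T}) p : entry (adj_mx R s) p = (p \in s)%:R.
Proof. by rewrite /entry mxE !enum_rankK -surjective_pairing. Qed.

Lemma entryP (X Y : 'M[R[i]]_#|T|) : entry X =1 entry Y -> X = Y.
Proof.
move=> e; apply/matrixP => i j.
by have := e (enum_val i, enum_val j); rewrite /entry /= !enum_valK.
Qed.

Lemma adj_mx_span c : c \in C -> adj_mx R c \in adj_span R C.
Proof. by move=> cC; rewrite memv_span // map_f ?mem_enum. Qed.

Lemma adj_spanP X : X \in adj_span R C ->
  exists w : {set T * T} -> R[i], X = \sum_(c in C) w c *: adj_mx R c.
Proof.
rewrite /adj_span span_def big_map big_enum => /memv_sumP[V VP ->].
have /fin_all_exists[w wP] c : exists k, c \in C -> V c = k *: adj_mx R c.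
  have [/VP/vlineP[k ->]|//] := boolP (c \in C); first by exists k.
  by exists 0.
by exists w; apply: eq_bigr.
Qed.

Lemma entry_sum (D : {set {set T * T}}) (w : {set T * T} -> R[i]) c p :
  trivIset D -> c \in D -> p \in c ->
  entry (\sum_(d in D) w d *: adj_mx R d) p = w c.
Proof.
move=> tD cD pc; rewrite /entry summxE (bigD1 c) //= big1 => [|d /andP[dD dc]].
  by rewrite addr0 mxE -/(entry _ p) entry_adj pc mulr1.
rewrite mxE -/(entry _ p) entry_adj.
case: (boolP (p \in d)) => pd; last by rewrite mulr0.
by rewrite -(def_pblock tD dD pd) (def_pblock tD cD pc) eqxx in dc.
Qed.

Lemma adj_mx_cover (D : {set {set T * T}}) : trivIset D ->
  adj_mx R (cover D) = \sum_(c in D) adj_mx R c.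
Proof.
move=> tD; apply: entryP => p; rewrite entry_adj.
under eq_bigr do rewrite -[adj_mx R _]scale1r.
case: (boolP (p \in cover D)) => [/bigcupP[c cD pc]|pD].
  by rewrite (entry_sum (fun=> 1) tD cD pc).
rewrite /entry summxE big1 // => c cD; rewrite mxE -/(entry _ p) entry_adj.
case: (boolP (p \in c)) => pc; last by rewrite mulr0.
by case/negP: pD; apply/bigcupP; exists c.
Qed.

Lemma adj_mx_transp (s : {set T * T}) :
  adj_mx R (transp_rel s) = adjmx (adj_mx R s).
Proof. by apply/matrixP => i j; rewrite !mxE inE conjC_nat. Qed.

Lemma adj_span_adjmx X : {in C, forall c, transp_rel c \in C} ->
  X \in adj_span R C -> adjmx X \in adj_span R C.
Proof.
move=> tC /adj_spanP[w ->].
have -> : adjmx (\sum_(c in C) w c *: adj_mx R c) =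
    \sum_(c in C) (w c)^* *: adj_mx R (transp_rel c).
  rewrite /adjmx raddf_sum raddf_sum; apply: eq_bigr => c _.
  rewrite adj_mx_transp; apply/matrixP => i j; rewrite !mxE.
  exact: (rmorphM Num.conj).
by apply: memv_suml => c cC; rewrite memvZ ?adj_mx_span ?tC.
Qed.

Lemma matrix_double_eq0 n (X : 'M[R[i]]_n) : X + X = 0 -> X = 0.
Proof.
move=> /eqP; rewrite -mulr2n -scaler_nat scaler_eq0 pnatr_eq0 /=.
by move/eqP.
Qed.

Section JordanAutomorphism.

Hypothesis CC : coherent_configuration R C.
Variable phi : {perm {set T * T}}.
Hypothesis phiJ : JAut R C phi.

Lemma JAut_mem c : (phi c \in C) = (c \in C).
Proof. by have [pC _] := phiJ; exact: perm_closed. Qed.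

Lemma JAut_tetrad : exists2 f : 'End('M[R[i]]_#|T|),
  {in C, forall c, f (adj_mx R c) = adj_mx R (phi c)} &
  forall W X Y Z, W \in adj_span R C -> X \in adj_span R C ->
    Y \in adj_span R C -> Z \in adj_span R C ->
    f (W *m X *m Y *m Z + Z *m Y *m X *m W) =
    f W *m f X *m f Y *m f Z + f Z *m f Y *m f X *m f W.
Proof.
have [_ _ tC mC] := CC; have [_ [f fphi [fA _ fJ]]] := phiJ.
exists f => // W X Y Z WA XA YA ZA.
have fin V : V \in adj_span R C -> f V \in adj_span R C.
  by move=> VA; rewrite -fA memv_img.
apply: (@jordan_tetrad _ (mem (adj_span R C)) f) => //.
- exact: matrix_double_eq0.
- exact: memvD.
- by move=> V VA; rewrite memvN.
(* Semiprimeness: the span is closed under adjoints, so [adjmx V] may serve as the middle factor. *)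
- move=> V VA VVV; apply: mulmx_adj_mul_eq0.
  by apply: VVV; apply: adj_span_adjmx.
- by move=> V; rewrite -{1}fA => /memv_imgP[U UA ->]; exists U.
- move=> U V UA VA; have := fJ U V UA VA; rewrite /jordan_mul linearZ /=.
  by move/(scalerI _) => ->; rewrite ?invr_eq0 ?pnatr_eq0.
Qed.

Lemma JAut_sum (F : {set T * T} -> 'M[R[i]]_#|T|) :
  \sum_(c in C) F (phi c) = \sum_(c in C) F c.
Proof.
rewrite [RHS](reindex_inj (@perm_inj _ phi)) /=.
by apply: eq_bigl => c; rewrite JAut_mem.
Qed.

(** Since [f] permutes the basis matrices as [phi] does, a fixed [X] has equal coefficients at [c]
    and [phi c]. *)
Lemma JAut_fixed_entry (f : 'End('M[R[i]]_#|T|)) X c p q :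
  {in C, forall c, f (adj_mx R c) = adj_mx R (phi c)} ->
  X \in adj_span R C -> f X = X -> c \in C -> p \in c -> q \in phi c ->
  entry X p = entry X q.
Proof.
move=> fphi /adj_spanP[w ->] fX cC pc qc.
have tC : trivIset C by have [/and3P[]] := CC.
rewrite (entry_sum _ tC cC pc) -fX linear_sum /=.
have -> : \sum_(d in C) f (w d *: adj_mx R d) =
    \sum_(d in C) w ((phi^-1)%g d) *: adj_mx R d.
  rewrite -[RHS]JAut_sum; apply: eq_bigr => d dC.
  by rewrite linearZ /= fphi // permK.
have pcC : phi c \in C by rewrite JAut_mem.
by rewrite (entry_sum _ tC pcC qc) permK.
Qed.

End JordanAutomorphism.

(** * Tetrads in an algebraic fusion *)

Section Fusion.

Hypothesis CC : coherent_configuration R C.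
Variable Phi : {group {perm {set T * T}}}.
Hypothesis PhiJ : {in Phi, forall phi, JAut R C phi}.

Let tC : trivIset C.
Proof. by have [/and3P[]] := CC. Qed.

Let orbit c : {set {set T * T}} := [set (phi : {perm _}) c | phi in Phi].

Let orbitS c : c \in C -> orbit c \subset C.
Proof.
move=> cC; apply/subsetP => _ /imsetP[phi /PhiJ pJ ->].
by rewrite (JAut_mem pJ).
Qed.

Let fusionE c : \bigcup_(phi in Phi) (phi : {perm _}) c = cover (orbit c).
Proof. by rewrite cover_imset. Qed.

Let adj_fusion s : s \in fusion Phi C ->
  exists2 c, c \in C & adj_mx R s = \sum_(d in orbit c) adj_mx R d.
Proof.
case/imsetP => c cC ->; exists c => //.
by rewrite fusionE adj_mx_cover //; apply: trivIsetS tC; apply: orbitS.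
Qed.

Let adj_fusion_span s : s \in fusion Phi C -> adj_mx R s \in adj_span R C.
Proof.
case/adj_fusion => c cC ->; apply: memv_suml => d dO.
by apply: adj_mx_span; apply: (subsetP (orbitS cC)).
Qed.

Let adj_fusion_fixed phi (f : 'End('M[R[i]]_#|T|)) s :
  phi \in Phi -> {in C, forall c, f (adj_mx R c) = adj_mx R (phi c)} ->
  s \in fusion Phi C -> f (adj_mx R s) = adj_mx R s.
Proof.
move=> pP fphi /adj_fusion[c cC ->]; rewrite linear_sum /=.
have -> : \sum_(d in orbit c) f (adj_mx R d) =
    \sum_(d in orbit c) adj_mx R (phi d).
  by apply: eq_bigr => d dO; apply: fphi; apply: (subsetP (orbitS cC)).
(* [phi] permutes the orbit of [c], because [Phi] is a group. *)
rewrite [RHS](reindex_inj (@perm_inj _ phi)) /=; apply: eq_bigl => d.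
apply/imsetP/imsetP => -[psi psiP].
  by move=> ->; exists (psi * phi)%g; rewrite ?groupM // permM.
move=> e; exists (psi * phi^-1)%g; first by rewrite groupM ?groupV.
by rewrite permM -e permK.
Qed.

(* A tetrad in the matrices of the fusion is fixed by every Jordan automorphism
   in [Phi], hence is constant on every relation of the fusion. *)
Lemma fusion_tetrad_entry a b c d s p q :
  a \in fusion Phi C -> b \in fusion Phi C -> c \in fusion Phi C ->
  d \in fusion Phi C -> s \in fusion Phi C -> p \in s -> q \in s ->
  let A := adj_mx R a in let B := adj_mx R b in
  let D := adj_mx R c in let E := adj_mx R d in
  entry (A *m B *m D *m E + E *m D *m B *m A) p =
  entry (A *m B *m D *m E + E *m D *m B *m A) q.
Proof.
move=> aS bS cS dS /imsetP[k kC ->] /bigcupP[phi phiP pk] /bigcupP[psi psiP qk].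
move=> A B D E.
have [mA mB mD mE] : [/\ A \in adj_span R C, B \in adj_span R C,
  D \in adj_span R C & E \in adj_span R C] by rewrite !adj_fusion_span.
have [_ _ _ mC] := CC.
have XA : A *m B *m D *m E + E *m D *m B *m A \in adj_span R C.
  by rewrite memvD // !mC.
(* This element carries [phi k], which contains [p], to [psi k], which contains [q]. *)
have thP : (phi^-1 * psi)%g \in Phi by rewrite groupM ?groupV.
have [f fth fT] := JAut_tetrad CC (PhiJ thP).
apply: (JAut_fixed_entry CC (PhiJ thP) fth XA _ _ pk).
- by rewrite fT // !(adj_fusion_fixed thP fth).
- by rewrite (JAut_mem (PhiJ phiP)).
- by rewrite permM permK.
Qed.

End Fusion.

End RelationSpan.

(** * Adjacency matrices of graphs of maps *)

Section Graphs.

Variables (R : realType) (T : finType).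

Definition graph (h : T -> T) : {set T * T} := [set p | p.2 == h p.1].

(** Row [x] of the first factor has its only 1 in column [h x], so composition is reversed. *)
Lemma adj_graph_mul (h k : T -> T) :
  adj_mx R (graph h) *m adj_mx R (graph k) = adj_mx R (graph (k \o h)).
Proof.
apply: entryP => -[x y]; rewrite entry_adj /entry mxE /=.
rewrite (bigD1 (enum_rank (h x))) //= big1 => [|i ih].
  by rewrite addr0 !mxE !inE /= !enum_rankK eqxx mul1r.
rewrite !mxE !inE /= !enum_rankK -(inj_eq enum_rank_inj) enum_valK.
by rewrite (negbTE ih) mul0r.
Qed.

Lemma entry_adj_graph h x y : entry (adj_mx R (graph h)) (x, y) = (y == h x)%:R.
Proof. by rewrite entry_adj inE. Qed.

Lemma entryD (X Y : 'M[R[i]]_#|T|) p : entry (X + Y) p = entry X p + entry Y p.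
Proof. by rewrite /entry mxE. Qed.

End Graphs.

(** * Alternative laws on basis elements of the loop ring *)

Section LoopRing.

Variables (K : comPzRingType) (S : finType) (op : S -> S -> S).

Let mul := @loop_ring_mul K S op.
Let delta (a : S) : {ffun S -> K} := [ffun z => (a == z)%:R].

Lemma loop_ring_mulDl f g h : mul (f + g) h = mul f h + mul g h.
Proof.
apply/ffunP => z; rewrite !ffunE -big_split /=; apply: eq_bigr => p _.
by rewrite ffunE mulrDl.
Qed.

Lemma loop_ring_mulDr f g h : mul f (g + h) = mul f g + mul f h.
Proof.
apply/ffunP => z; rewrite !ffunE -big_split /=; apply: eq_bigr => p _.
by rewrite ffunE mulrDr.
Qed.

Lemma loop_ring_mul_delta a b : mul (delta a) (delta b) = delta (op a b).
Proof.
apply/ffunP => z; rewrite !ffunE.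
rewrite (eq_bigr (fun p : S * S => ((a, b) == p)%:R)) => [|p _]; last first.
  by rewrite !ffunE -natrM mulnb -xpair_eqE -surjective_pairing.
rewrite big_mkcond (bigD1 (a, b)) //= big1 => [|p pab].
  by rewrite addr0 eqxx; case: ifP.
by rewrite [_ == p]eq_sym (negbTE pab) if_same.
Qed.

Hypothesis mul_alt : alternative mul.

(** Polarization of the left alternative law at [delta a + delta b], read off at the coefficient of
    [z]. *)
Lemma linearized_left_alternative a b c z :
  (op (op a b) c == z)%:R + (op (op b a) c == z)%:R =
  (op a (op b c) == z)%:R + (op b (op a c) == z)%:R :> K.
Proof.
have E d : mul (mul (delta d) (delta d)) (delta c) =
    mul (delta d) (mul (delta d) (delta c)) := proj1 (mul_alt _ _).
have := proj1 (mul_alt (delta a + delta b) (delta c)); rewrite -/mul.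
rewrite !(loop_ring_mulDl, loop_ring_mulDr) !E !loop_ring_mul_delta.
move/ffunP/(_ z); rewrite !ffunE !addrA => /addIr.
by rewrite -!addrA => /addrI.
Qed.

Lemma right_alternative_delta a b :
  delta (op (op b a) a) = delta (op b (op a a)).
Proof.
have := proj2 (mul_alt (delta a) (delta b)).
by rewrite -/mul !loop_ring_mul_delta.
Qed.

End LoopRing.

(** * Left translations of an RA-loop *)

Section RALoop.

Variables (R : realType) (S : finType) (op : S -> S -> S).
Hypothesis op_RA : RA_loop op.

Let K := R[i].

Let left_alt a b c z :
  (op (op a b) c == z)%:R + (op (op b a) c == z)%:R =
  (op a (op b c) == z)%:R + (op b (op a c) == z)%:R :> K.
Proof. by apply: linearized_left_alternative; have [_] := op_RA. Qed.

Let injl a : injective (op a).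
Proof. by have [[_ opl _] _] := op_RA; apply: bij_inj. Qed.

Let injr a : injective (op^~ a).
Proof. by have [[_ _ opr] _] := op_RA; apply: bij_inj. Qed.

Lemma RA_right_alternative a b : op (op b a) a = op b (op a a).
Proof.
have [_ /(_ K)/right_alternative_delta/(_ a b)/ffunP] := op_RA.
move=> /(_ (op (op b a) a)).
rewrite !ffunE eqxx => /esym/eqP.
by rewrite pnatr_eq1 eqb1 => /eqP ->.
Qed.

(* If [st = ts = e], the linearized left alternative law for [s, t, x] reads
   [2x = s(tx) + t(sx)] in the loop ring. *)
Lemma RA_left_inverse s : exists t, cancel (op s) (op t).
Proof.
have [[[e [le re]] opl opr] _] := op_RA.
have [t st] : exists t, op s t = e by have [g _ gK] := opl s; exists (g e).
(* The linearized law for [s, t, s]: by right alternativity [(ts)s] cancels [t(ss)], leaving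
   [s = s(ts)]. *)
have ts : op t s = e.
  apply: (@injl s); rewrite re; apply/eqP; have := left_alt s t s s.
  rewrite st le eqxx RA_right_alternative => /addIr/esym/eqP.
  by rewrite pnatr_eq1 eqb1.
exists t => x; apply/eqP; have := left_alt s t x x.
rewrite st ts le eqxx -!natrD => /eqP; rewrite eqr_nat.
by case: (op t _ == x) => //; case: (_ == x).
Qed.

Let H : {set {set S * S}} := [set hat op s | s : S].

Let hat_graph s : hat op s = graph (op s). Proof. by []. Qed.

Lemma hat_mem s : hat op s \in H. Proof. exact: imset_f. Qed.

Lemma RA_hat_partition : partition H [set: S * S].
Proof.
have [[[e [le re]] opl opr] _] := op_RA.
apply/and3P; split.
- apply/eqP/setP => -[x y]; rewrite inE; apply/bigcupP.
  have [g gK Kg] := opr x.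
  by exists (hat op (g y)); rewrite ?hat_mem // inE /= Kg.
- apply/trivIsetP => _ _ /imsetP[s _ ->] /imsetP[t _ ->] st.
  apply/pred0P => -[x y] /=; rewrite !inE /=; apply/negP => /andP[/eqP -> /eqP].
  by move/injr => e1; rewrite e1 eqxx in st.
- apply/imsetP => -[s _ /setP/(_ (e, op s e))].
  by rewrite !inE eqxx.
Qed.

Lemma RA_hat_transp s : transp_rel (hat op s) \in H.
Proof.
have [t sK] := RA_left_inverse s; have Ks := canF_sym sK.
suff -> : transp_rel (hat op s) = hat op t by exact: hat_mem.
apply/setP => -[x y]; rewrite !inE /=.
by apply/eqP/eqP => ->.
Qed.

(** This is the linearized left alternative law applied pointwise: a single product need not be a
    translation matrix, but the symmetrized one is a sum of two. *)
Lemma RA_hat_mul s t :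
  adj_mx R (hat op s) *m adj_mx R (hat op t) +
  adj_mx R (hat op t) *m adj_mx R (hat op s) =
  adj_mx R (hat op (op t s)) + adj_mx R (hat op (op s t)).
Proof.
rewrite !hat_graph !adj_graph_mul; apply: entryP => -[x y].
rewrite !entryD !entry_adj_graph /=.
by rewrite ![y == _]eq_sym left_alt.
Qed.

Lemma RA_hat_jordan_scheme : jordan_scheme R H.
Proof.
have [[[e [le re]] opl opr] _] := op_RA.
split.
- exact: RA_hat_partition.
- suff -> : diag_rel S = hat op e by exact: hat_mem.
  by apply/setP => p; rewrite !inE le eq_sym.
- by move=> _ /imsetP[s _ ->]; exact: RA_hat_transp.
- move=> _ _ /adj_spanP[w ->] /adj_spanP[w' ->]; rewrite /jordan_mul memvZ //.
  rewrite !mulmx_suml; under eq_bigr do rewrite mulmx_sumr.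
  under [X in _ + X]eq_bigr do rewrite mulmx_sumr.
  (* The exchange brings both orders of a pair of relations under the same coefficient. *)
  rewrite [X in _ + X]exchange_big -big_split.
  apply: memv_suml => _ /imsetP[s _ ->].
  rewrite -big_split; apply: memv_suml => _ /imsetP[t _ ->] /=.
  rewrite -!scalemxAl -!scalemxAr !scalerA [w' _ * _]mulrC -scalerDr RA_hat_mul.
  by rewrite memvZ // memvD // adj_mx_span // hat_mem.
Qed.

(* Let [M y = a(b(t y))] and [M' x = t(b(a x))] with [t] inverse to [ab].  The
   tetrad of [c, t, b, a] takes the value [[M(cx) = cx] + [M' x = x]] (Iverson
   brackets) at [(x, cx)], independently of [x].  Averaging over [x] shows that this value
   does not depend on [c] either, so neither does [[M c = c]]; as [M] fixes
   [ab], it is the identity. *)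
Lemma RA_fusion_associative C : coherent_configuration R C ->
  is_algebraic_fusion R C H -> associative op.
Proof.
move=> CC [Phi PhiJ HE] a b z.
have [[[e [le re]] opl opr] _] := op_RA.
have [t abK] := RA_left_inverse (op a b).
pose m c := op a (op b (op t c)) == c; pose m' x := op t (op b (op a x)) == x.
have const c x y : (m (op c x) + m' x = m (op c y) + m' y)%N.
  have hatS s : hat op s \in fusion Phi C by rewrite -HE hat_mem.
  have gr u : (u, op c u) \in hat op c by rewrite inE.
  have := fusion_tetrad_entry CC PhiJ (hatS c) (hatS t) (hatS b) (hatS a)
    (hatS c) (gr x) (gr y).
  rewrite /= !hat_graph !adj_graph_mul !entryD !entry_adj_graph /= -!natrD.
  (* The reversed tetrad maps [x] to [c(M' x)]; cancelling [c] turns its condition into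
     [M' x = x]. *)
  move/eqP; rewrite eqr_nat !(inj_eq (@injl c)) /m /m'.
  rewrite ![op c _ == op a _]eq_sym.
  by rewrite [x == _]eq_sym [y == _]eq_sym => /eqP.
(* The constant is taken at [x = e], and [x] to [cx] permutes [S], so the right side is free of
   [c]. *)
have avg c : (#|S| * (m c + m' e) = \sum_x m x + \sum_x m' x)%N.
  rewrite [X in _ = (X + _)%N](reindex_inj (@injl c)) -big_split /=.
  rewrite -sum_nat_const; apply: eq_bigr => x _.
  by have := const c e x; rewrite re.
have mab : m (op a b) by rewrite /m -{1}[op a b]re abK re.
have /eqP : (#|S| * (m (op (op a b) z) + m' e) = #|S| * (m (op a b) + m' e))%N.
  by rewrite !avg.
rewrite eqn_pmul2l; last by apply/card_gt0P; exists e.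
(* As [t] cancels [ab], the condition [M c = c] at [c = (ab)z] reads [a(bz) = (ab)z]. *)
by rewrite eqn_add2r mab eqb1 /m abK => /eqP.
Qed.

End RALoop.

Theorem theorem4p4 (R : realType) (S : finType) (op : S -> S -> S)
    (op_RA : RA_loop op) (op_nonassoc : ~ associative op) :
  autonomous_jordan_scheme R [set hat op s | s : S].
Proof.
split; first exact: RA_hat_jordan_scheme.
by move=> C CC /(RA_fusion_associative op_RA CC).
Qed.
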